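(* Let $\gamma_1(t)=e^{-\pi t^2}$, $\gamma_2(t)=2\pi t\,e^{-\pi t^2}$ and $\gamma_3(t)=(1-2\pi t)e^{-\pi t^2}$ for $t\in\mathbb{R}$. Let $\varphi,\psi\in L^2(\mathbb{R})$ satisfy $|\mathcal{F}[\gamma_j\varphi](\xi)|=|\mathcal{F}[\gamma_j\psi](\xi)|$ for all $\xi\in\mathbb{R}$ and $j=1,2,3$. Then there exists $c\in\mathbb{C}$ with $|c|=1$ such that $\psi=c\varphi$.
   Context: The Fourier transform is normalized as $\mathcal{F}f(\xi)=\int_{\mathbb{R}}f(x)e^{-2\pi i x\xi}\,dx$ for $f\in L^1(\mathbb{R})$, extended to $L^2(\mathbb{R})$ in the usual way. Equalities of functions in $L^2$ are understood almost everywhere. *)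

(* Defs.v *)
From mathcomp Require Import all_boot all_order all_algebra.
From mathcomp Require Import all_classical all_reals all_analysis.
From mathcomp Require Export complex.
Import GRing.Theory Num.Theory.
Local Open Scope ring_scope.
Local Open Scope complex_scope.

Set Implicit Arguments. Unset Strict Implicit. Unset Printing Implicit Defensive.

Definition gamma1 (R : realType) (t : R) : R := expR (- (pi * t ^+ 2)).
Definition gamma2 (R : realType) (t : R) : R := 2 * pi * t * expR (- (pi * t ^+ 2)).
Definition gamma3 (R : realType) (t : R) : R := (1 - 2 * pi * t) * expR (- (pi * t ^+ 2)).

Definition cexpi (R : realType) (theta : R) : R[i] := cos theta +i* sin theta.

Definition rmulf (R : realType) (g : R -> R) (f : R -> R[i]) : R -> R[i] :=
  fun x => (g x)%:C * f x.

(* f is (a representative of) an element of L^2(R) : measurable with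
   finite integral of |f|^2 = Re^2 + Im^2 w.r.t. Lebesgue measure. *)
Definition L2 (R : realType) (f : R -> R[i]) : Prop :=
  measurable_fun setT (fun x => complex.Re (f x)) /\
  measurable_fun setT (fun x => complex.Im (f x)) /\
  (@lebesgue_measure R).-integrable setT
     (fun x => ((complex.Re (f x)) ^+ 2 + (complex.Im (f x)) ^+ 2)%:E).

Definition fourier (R : realType) (f : R -> R[i]) (xi : R) : R[i] :=
  (Rintegral (@lebesgue_measure R) setT
     (fun x => complex.Re (f x * cexpi (- (2 * pi * x * xi)))))
  +i*
  (Rintegral (@lebesgue_measure R) setT
     (fun x => complex.Im (f x * cexpi (- (2 * pi * x * xi))))).

(* Main.v *)
Require Import Defs.
From mathcomp Require Import all_boot all_order all_algebra.
From mathcomp Require Import all_classical all_reals all_analysis.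
From mathcomp Require Import complex.
From mathcomp Require Import measurable_realfun ring lra.
Import Order.TTheory GRing.Theory Num.Theory numFieldNormedType.Exports.
Set Implicit Arguments. Unset Strict Implicit. Unset Printing Implicit Defensive.
Local Open Scope classical_set_scope.
Local Open Scope ring_scope.
Local Open Scope complex_scope.

(** Let F and G be the transforms of gamma1 phi and gamma1 psi, as functions of
z = 2 pi xi. Differentiating under the integral, gamma2 phi has transform
2 pi i F' and gamma3 phi has transform F - 2 pi i F', so the three
hypotheses give |F| = |G|, |F'| = |G'| and Im (F F'^* ) = Im (G G'^* ); the
first one also gives Re (F F'^* ) = Re (G G'^* ) by differentiation. Hence
(G / F)' = 0 wherever F does not vanish, and G = c F with |c| = 1 on some
interval (with c = 1 if F = 0).

It remains to see that h = gamma1 (psi - c phi), whose transform vanishes near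
some point a, is zero almost everywhere. Differentiating at a, all the moments
of h(t) e^{-ita} vanish; its real and imaginary parts k are real functions with
Gaussian decay and vanishing moments. Integrating the exponential series
termwise, every k(t) e^{-j (t - s)^2} has vanishing moments too; integrating it
once more, k is orthogonal to exp (- e^{n^2 - (t - x - n)^2}), which tends
boundedly to the indicator of t < x as n grows. So the primitive of k is zero,
and k = 0 almost everywhere by Lebesgue differentiation. *)

(** * Dominated convergence and termwise integration of real functions *)

Section dominated.
Context d (T : measurableType d) (R : realType) (mu : {measure set T -> \bar R}).

Lemma le_integrable_real (f g : T -> R) : measurable_fun setT f ->
  (forall t, `|f t| <= g t) ->
  mu.-integrable setT (EFin \o g) -> mu.-integrable setT (EFin \o f).
Proof.
move=> mf fg; apply: le_integrable => //; first exact/measurable_EFinP.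
by move=> t _ /=; rewrite lee_fin (le_trans (fg t))// ler_norm.
Qed.

Lemma integrable_realM (c : R) (f : T -> R) : mu.-integrable setT (EFin \o f) ->
  mu.-integrable setT (EFin \o (fun t => c * f t)).
Proof. by move=> /(integrableZl measurableT c). Qed.

Lemma integrable_real_norm (f : T -> R) : mu.-integrable setT (EFin \o f) ->
  mu.-integrable setT (EFin \o (fun t => `|f t|)).
Proof. by move=> /integrable_abse. Qed.

Lemma integrable_realD (f g : T -> R) : mu.-integrable setT (EFin \o f) ->
  mu.-integrable setT (EFin \o g) ->
  mu.-integrable setT (EFin \o (fun t => f t + g t)).
Proof. by move=> /(integrableD measurableT) /[apply]. Qed.

(** Both limit passages of the proof have this shape: the partial sums of the exponential series,
    and the double exponentials that approach a half-line. *)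
Lemma dominated_Rintegral0 (f_ : nat -> T -> R) (f g : T -> R) :
  (forall n, measurable_fun setT (f_ n)) -> measurable_fun setT f ->
  {ae mu, forall t, f_ n t @[n --> \oo] --> f t} ->
  mu.-integrable setT (EFin \o g) ->
  (forall n t, `|f_ n t| <= g t) ->
  (forall n, \int[mu]_t f_ n t = 0) -> \int[mu]_t f t = 0.
Proof.
move=> mf_ mf cf ig fg f0.
have i_ n : mu.-integrable setT (EFin \o f_ n).
  by apply: le_integrable_real ig => // t; exact: fg.
have cf' : {ae mu, forall t, setT t ->
    (EFin \o f_ n) t @[n --> \oo] --> (EFin \o f) t}.
  by apply: filterS cf => t ft _ /=; apply: cvg_comp ft _; exact: cvg_id.
have fg' : {ae mu, forall t n, setT t ->
    (`|(EFin \o f_ n) t| <= (EFin \o g) t)%E}.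
  by apply: aeW => t n _; rewrite /= lee_fin.
have [_ _] := dominated_convergence measurableT
  (fun n => (measurable_EFinP _ _).2 (mf_ n)) ((measurable_EFinP _ _).2 mf)
  cf' ig fg'.
rewrite [X in X @ _ --> _ -> _](_ : _ = fun=> 0%E); last first.
  apply/funext => n /=; transitivity (\int[mu]_t f_ n t)%:E; last by rewrite f0.
  by rewrite /Rintegral fineK//; exact: (integrable_fin_num measurableT (i_ n)).
move=> H; rewrite /Rintegral.
suff -> : (\int[mu]_t (f t)%:E = 0)%E by [].
by apply: (cvg_unique _ H) => //; exact: cvg_cst.
Qed.

(* Termwise integration of the exponential series. *)
Lemma Rintegral_expR0 (w k : T -> R) :
  measurable_fun setT w -> measurable_fun setT k ->
  mu.-integrable setT (EFin \o (fun t => expR `|w t| * `|k t|)) ->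
  (forall j, \int[mu]_t (w t ^+ j * k t) = 0) ->
  \int[mu]_t (expR (w t) * k t) = 0.
Proof.
move=> mw mk ig wk.
(* This bound, uniform in [n], makes the integrable function of the hypothesis a dominating
   function. *)
have expS (x : R) n : `|series (exp_coeff x) n| <= expR `|x|.
  have h : `|series (exp_coeff x) n| <= series (exp_coeff `|x|) n.
    rewrite /series/= (le_trans (ler_norm_sum _ _ _))//; apply: ler_sum => i _.
    by rewrite /exp_coeff /= normf_div normrX (ger0_norm (ler0n _ _)).
  apply: (le_trans h); rewrite /expR; apply: nondecreasing_cvgn_le.
    by apply: nondecreasing_series => i _ _; rewrite exp_coeff_ge0.
  exact: is_cvg_series_exp_coeff.
(* Each term is integrable because |w|^j <= j! e^{|w|}. *)
have wj j : mu.-integrable setT (EFin \o (fun t => w t ^+ j * k t)).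
  apply: le_integrable_real (integrable_realM j`!%:R ig).
    apply: measurable_funM => //; exact: measurable_funX.
  move=> t; rewrite normrM mulrA ler_wpM2r// normrX.
  case: j => [|j]; first by rewrite expr0 mul1r -expR0 ler_expR.
  have := expR_ge1Dxn j (normr_ge0 (w t)).
  rewrite -ler_pdivrMl ?ltr0n ?fact_gt0//; apply: le_trans.
  by rewrite mulrC lerDr.
apply: (@dominated_Rintegral0
  (fun n t => series (exp_coeff (w t)) n * k t) _ _ _ _ _ ig).
- move=> n; apply: measurable_funM => //.
  rewrite /series/=; apply: measurable_sum => i.
  by apply: measurable_funM => //; exact: measurable_funX.
- by apply: measurable_funM => //; exact: measurableT_comp.
- apply: aeW => t; apply: cvgM; last exact: cvg_cst.
  exact: is_cvg_series_exp_coeff.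
- by move=> n t; rewrite normrM ler_wpM2r.
- elim=> [|n IH].
    under eq_Rintegral do rewrite /series/= big_geq// mul0r.
    by rewrite /Rintegral integral0.
  have iS : forall n, mu.-integrable setT (EFin \o (fun t => series (exp_coeff (w t)) n * k t)).
    move=> m; apply: le_integrable_real ig.
      apply: measurable_funM => //.
      rewrite /series/=; apply: measurable_sum => i.
      by apply: measurable_funM => //; exact: measurable_funX.
    by move=> t; rewrite normrM ler_wpM2r.
  have -> : \int[mu]_t (series (exp_coeff (w t)) n.+1 * k t) =
    \int[mu]_t (series (exp_coeff (w t)) n * k t + n`!%:R^-1 * (w t ^+ n * k t)).
    apply: eq_Rintegral => t _.
    by rewrite /series/= big_nat_recr//= mulrDl /exp_coeff/= (mulrC _ n`!%:R^-1) -mulrA.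
  rewrite RintegralD//; last exact: integrable_realM.
  by rewrite IH RintegralZl// wk mulr0 addr0.
Qed.
End dominated.

(** * Functions with Gaussian decay *)

Section gdecay.
Variable R : realType.
Local Notation mu := (@lebesgue_measure R).
Implicit Types (k f : R -> R) (p : {poly R}).

(* The term [s * `|t|] leaves room for the factors [expR ((t - c) ^+ 2)], for all
   [c], and for polynomials. *)
Definition gdecay k := measurable_fun setT k /\
  forall s : R, mu.-integrable setT
    (EFin \o (fun t => expR (t ^+ 2 + s * `|t|) * k t)).

Lemma gdecay_integrable k f C s : gdecay k -> measurable_fun setT f ->
  (forall t, `|f t| <= C * expR (t ^+ 2 + s * `|t|)) ->
  mu.-integrable setT (EFin \o (fun t => f t * k t)).
Proof.
move=> [mk ik] mf fC.
apply: le_integrable_real (integrable_realM C (integrable_real_norm (ik s))).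
  exact: measurable_funM.
move=> t; rewrite !normrM mulrA ler_wpM2r// (ger0_norm (expR_ge0 _)).
exact: fC.
Qed.

(** The growth rate [s] of [f] is absorbed by using the decay of [k] at the parameter [r + s]. *)
Lemma gdecayM k f C s : gdecay k -> measurable_fun setT f ->
  (forall t, `|f t| <= C * expR (s * `|t|)) -> gdecay (fun t => f t * k t).
Proof.
move=> gk mf fC; split; first by apply: measurable_funM => //; case: gk.
move=> r; under eq_fun do rewrite /= mulrA.
apply: (@gdecay_integrable _ _ C (r + s)) => //.
  apply: measurable_funM => //; apply: measurableT_comp => //.
  apply: measurable_funD; first exact: measurable_funX.
  by apply: measurable_funM => //; exact: measurableT_comp.
move=> t; rewrite normrM ger0_norm ?expR_ge0// mulrDl addrA [in leRHS]expRD mulrCA.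
by rewrite ler_wpM2l// expR_ge0.
Qed.

Lemma gdecay_bounded k f : gdecay k -> measurable_fun setT f ->
  (forall t, `|f t| <= 1) -> gdecay (fun t => f t * k t).
Proof.
move=> gk mf f1; apply: (@gdecayM _ _ 1 0) => // t.
by rewrite mul0r expR0 mulr1.
Qed.

Lemma gdecay_cst k c : gdecay k -> gdecay (fun t => c * k t).
Proof.
by move=> gk; apply: (@gdecayM _ _ `|c| 0) => // t; rewrite mul0r expR0 mulr1.
Qed.

Lemma gdecay_id k : gdecay k -> gdecay (fun t => t * k t).
Proof.
move=> gk; apply: (@gdecayM _ _ 1 1) => // t; rewrite !mul1r.
by rewrite (le_trans _ (expR_ge1Dx _))// lerDr.
Qed.

Lemma gdecayD k1 k2 : gdecay k1 -> gdecay k2 -> gdecay (fun t => k1 t + k2 t).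
Proof.
move=> [m1 i1] [m2 i2]; split; first exact: measurable_funD.
by move=> s; under eq_fun do rewrite /= mulrDr; exact: integrable_realD.
Qed.

Lemma gdecayN k : gdecay k -> gdecay (fun t => - k t).
Proof. by move=> /(gdecay_cst (-1)); under eq_fun do rewrite mulN1r. Qed.

Lemma integrable_gdecay k : gdecay k -> mu.-integrable setT (EFin \o k).
Proof.
move=> gk; have := @gdecay_integrable _ (cst 1) 1 0 gk.
under eq_fun do rewrite /= mul1r; apply => // t.
by rewrite normr1 mul1r mul0r addr0 -expR0 ler_expR sqr_ge0.
Qed.

Lemma gdecay_horner k p : gdecay k -> gdecay (fun t => p.[t] * k t).
Proof.
move=> gk; elim/poly_ind: p => [|p c IH].
  under eq_fun do rewrite horner0; exact: gdecay_cst.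
rewrite [X in gdecay X](_ : _ = (fun t => t * (p.[t] * k t) + c * k t)).
  by apply: gdecayD; [exact: gdecay_id|exact: gdecay_cst].
by apply/funext => t; rewrite hornerMXaddC mulrDl mulrA (mulrC t).
Qed.

(** Since pi > 2, e^{t^2 + s|t|} [gamma1 t] still decays like a Gaussian and is square integrable;
    its product with [f] is then dominated by the sum of the two squares. *)
Lemma gdecay_gamma1 f : measurable_fun setT f ->
  mu.-integrable setT (EFin \o (fun t => f t ^+ 2)) ->
  gdecay (fun t => gamma1 t * f t).
Proof.
move=> mf if2.
have mg : measurable_fun setT (@gamma1 R).
  apply: measurableT_comp => //; apply: measurableT_comp => //.
  by apply: measurable_funM => //; exact: measurable_funX.
have me (s : R) : measurable_fun setT (fun t : R => expR (t ^+ 2 + s * `|t|)).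
  apply: measurableT_comp => //; apply: measurable_funD; first exact: measurable_funX.
  by apply: measurable_funM => //; exact: measurableT_comp.
split; first exact: measurable_funM.
move=> s.
have := integrable_realD (integrable_realM (expR (s ^+ 2)) (@integrableT_gauss R)) if2.
apply: le_integrable_real.
  by apply: measurable_funM; [exact: me|exact: measurable_funM].
move=> t; rewrite mulrA normrM.
rewrite ger0_norm ?mulr_ge0 ?expR_ge0// -expRD /gauss_fun -expRD.
set a := t ^+ 2 + _ + _.
(* The gap between the two exponents is (s - |t|)^2 + 2 (pi - 2) t^2. *)
have ha : expR a ^+ 2 <= expR (s ^+ 2 - t ^+ 2).
  rewrite expr2 -expRD ler_expR /a.
  have := pi_ge2 R => hpi.
  have : 0 <= (pi - 2) * t ^+ 2 by rewrite mulr_ge0 ?sqr_ge0// subr_ge0.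
  have := sqr_ge0 (s - `|t|); rewrite sqrrB real_normK ?num_real//.
  nra.
have := sqr_ge0 (expR a - `|f t|).
rewrite sqrrB real_normK ?num_real// => h.
have : 0 <= expR a * `|f t| by rewrite mulr_ge0 ?expR_ge0.
move: ha h; rewrite mulr2n; lra.
Qed.

End gdecay.

(** * Gaussian decay and vanishing moments force a function to be zero *)

Section moments.
Variable R : realType.
Local Notation mu := (@lebesgue_measure R).
Implicit Types (k f : R -> R) (p : {poly R}).

(** The terms of the exponential series of e^{-(t - c)^2} are polynomials, so they integrate to 0
    against [k]. The majorant of the series is e^{(t - c)^2}, which is why [gdecay] includes the
    growth e^{t^2}. *)
Lemma gauss_factor_moments0 k c : gdecay k ->
  (forall p, \int[mu]_t (p.[t] * k t) = 0) ->
  forall p, \int[mu]_t (p.[t] * (expR (- (t - c) ^+ 2) * k t)) = 0.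
Proof.
move=> gk k0 p.
have mq : measurable_fun setT (fun t : R => - (t - c) ^+ 2).
  by apply: measurableT_comp => //; apply: measurable_funX; exact: measurable_funB.
under eq_Rintegral do rewrite mulrCA.
apply: Rintegral_expR0 => //.
- by case: (gdecay_horner p gk).
- rewrite [X in integrable _ _ X](_ : _ = (EFin \o
    (fun t => `|expR ((t - c) ^+ 2) * (p.[t] * k t)|))); last first.
    apply/funext => t /=.
    by rewrite normrN normrX real_normK ?num_real// [in RHS]normrM (ger0_norm (expR_ge0 _)).
  apply: integrable_real_norm.
  apply: (@gdecay_integrable _ _ _ (expR (c ^+ 2)) (2 * `|c|)).
  + exact: gdecay_horner.
  + by apply: measurableT_comp => //; apply: measurable_funX; exact: measurable_funB.
  + move=> t; rewrite ger0_norm ?expR_ge0// -expRD ler_expR.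
    have : - (t * c) <= `|c| * `|t| by rewrite -normrM mulrC -normrN ler_norm.
    rewrite sqrrB mulr2n; lra.
- move=> j; rewrite -[RHS](k0 ((- ('X - c%:P) ^+ 2) ^+ j * p)).
  by apply: eq_Rintegral => t _; rewrite hornerM horner_exp hornerN horner_exp hornerXsubC mulrA.
Qed.

Lemma gdecay_gauss_power k c j : gdecay k ->
  gdecay (fun t => expR (- (t - c) ^+ 2) ^+ j * k t).
Proof.
move=> gk; apply: gdecay_bounded => //.
  apply: measurable_funX; apply: measurableT_comp => //.
  by apply: measurableT_comp => //; apply: measurable_funX; exact: measurable_funB.
move=> t; rewrite normrX exprn_ile1// ger0_norm ?expR_ge0//.
by rewrite -expR0 ler_expR oppr_le0 sqr_ge0.
Qed.

(** The Gaussian factors are introduced one at a time: expanding the [j]-th power at once would need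
    the majorant e^{j (t - c)^2}, beyond what [gdecay] controls for j > 1. The induction therefore
    carries all polynomials [p]. *)
Lemma gauss_power_moments0 k c j : gdecay k ->
  (forall p, \int[mu]_t (p.[t] * k t) = 0) ->
  \int[mu]_t (expR (- (t - c) ^+ 2) ^+ j * k t) = 0.
Proof.
move=> gk k0.
suff /(_ 1) : forall p,
    \int[mu]_t (p.[t] * (expR (- (t - c) ^+ 2) ^+ j * k t)) = 0.
  by under eq_Rintegral do rewrite hornerC mul1r.
elim: j => [|j kj] p; first by under eq_Rintegral do rewrite expr0 mul1r.
under eq_Rintegral do rewrite exprS -mulrA.
by apply: gauss_factor_moments0 => //; exact: gdecay_gauss_power.
Qed.

(* The double exponential tends to the indicator of a half-line. *)
Lemma moments0_halfline k x : gdecay k ->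
  (forall p, \int[mu]_t (p.[t] * k t) = 0) ->
  \int[mu]_(t in `]-oo, x]) k t = 0.
Proof.
move=> gk k0.
(* The inner exponent n^2 - (t - x - n)^2 equals (t - x) (2n - (t - x)), which tends to minus
   infinity for t < x and to plus infinity for t > x. *)
pose e n (t : R) := expR (- (expR (n%:R ^+ 2) * expR (- (t - (x + n%:R)) ^+ 2))).
have mv n : measurable_fun setT
    (fun t : R => expR (n%:R ^+ 2) * expR (- (t - (x + n%:R)) ^+ 2)).
  apply: measurable_funM => //.
  apply: measurableT_comp => //; apply: measurableT_comp => //.
  by apply: measurable_funX; exact: measurable_funB.
have mw n : measurable_fun setT
    (fun t : R => - (expR (n%:R ^+ 2) * expR (- (t - (x + n%:R)) ^+ 2))).
  exact: measurableT_comp.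
have mk : measurable_fun setT k by case: gk.
rewrite Rintegral_mkcond.
apply: (@dominated_Rintegral0 _ _ _ mu (fun n t => e n t * k t) _ (fun t => `|k t|)).
- by move=> n; apply: measurable_funM => //; exact: (measurableT_comp (@measurable_expR R) (mw n)).
- have mD : measurable (`]-oo, x]%classic : set R) by [].
  by apply/(measurable_restrictT k mD); exact: measurable_funTS.
(* At t = x the double exponential is constantly e^{-1}, so this null set is excluded. *)
- exists [set x]; split; [exact: measurable_set1|exact: lebesgue_measure_set1|].
  move=> t /=; apply: contra_notP => /eqP tx.
  have eE n : e n t = expR (- expR ((t - x) * (n%:R *+ 2 - (t - x)))).
    by rewrite /e -expRD; congr (expR (- expR _)); rewrite mulr2n; ring.
  rewrite patchE; move: tx; rewrite neq_lt => /orP[tx|tx].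
    rewrite mem_set /=; last by rewrite in_itv/= ltW.
    suff H : e n t @[n --> \oo] --> (1 : R).
      suff : e n t * k t @[n --> \oo] --> 1 * k t by rewrite mul1r.
      exact: cvgMr_tmp.
    under eq_fun do rewrite eE.
    suff H : expR ((t - x) * (n%:R *+ 2 - (t - x))) @[n --> \oo] --> (0 : R).
      suff : expR (- expR ((t - x) * (n%:R *+ 2 - (t - x)))) @[n --> \oo] -->
        expR (- 0 : R) by rewrite oppr0 expR0.
      by apply: continuous_cvg; [exact: continuous_expR|exact: cvgN].
    rewrite (_ : (fun n => _) = (fun y => expR (- y)) \o
      (fun n : nat => (x - t) * (n%:R *+ 2 + (x - t)))); last first.
      by apply/funext => n /=; congr expR; rewrite mulr2n; ring.
    apply: cvg_comp; last exact: cvgr_expR.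
    apply/cvgryPge => A; near=> n.
    have hn : A / (x - t) <= n%:R by near: n; exact: nbhs_infty_ger.
    have d0 : 0 < x - t by rewrite subr_gt0.
    rewrite -ler_pdivrMl// mulrC (le_trans hn)// mulr2n.
    by have := ler0n R n; lra.
  rewrite memNset /=; last by rewrite in_itv/= leNgt tx.
  suff H : e n t @[n --> \oo] --> (0 : R).
    suff : e n t * k t @[n --> \oo] --> 0 * k t by rewrite mul0r.
    exact: cvgMr_tmp.
  under eq_fun do rewrite eE.
  apply: (@cvg_comp _ _ _ (fun n : nat => expR ((t - x) * (n%:R *+ 2 - (t - x))))
    (fun y => expR (- y))); last exact: cvgr_expR.
  apply/cvgryPge => A; near=> n.
  have hn : A / (t - x) + (t - x) <= n%:R by near: n; exact: nbhs_infty_ger.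
  have d0 : 0 < t - x by rewrite subr_gt0.
  apply: (le_trans _ (expR_ge1Dx _)).
  have : A <= (t - x) * (n%:R *+ 2 - (t - x)).
    rewrite -ler_pdivrMl// mulrC mulr2n.
    by have := ler0n R n; lra.
  lra.
- by apply: integrable_real_norm; exact: integrable_gdecay.
- move=> n t; rewrite normrM ler_piMl// ger0_norm ?expR_ge0//.
  by rewrite /e -expR0 ler_expR oppr_le0 mulr_ge0 ?expR_ge0.
(* Second use of the exponential series, now in powers of the inner Gaussian. That Gaussian times
   e^{n^2} is at most e^{n^2}, so for fixed [n] the majorant is a constant times |k|. *)
- move=> n; apply: Rintegral_expR0; [exact: mw|exact: mk| |].
    rewrite [X in integrable _ _ X](_ : _ = (EFin \o (fun t =>
       `|expR (expR (n%:R ^+ 2) * expR (- (t - (x + n%:R)) ^+ 2)) * k t|))).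
      apply: integrable_real_norm.
      apply: (@gdecay_integrable _ _ _ (expR (expR (n%:R ^+ 2))) 0) => //.
        by apply: measurableT_comp => //; exact: mv.
      move=> t; rewrite mul0r addr0 ger0_norm ?expR_ge0// -[leLHS]mulr1.
      rewrite ler_pM ?expR_ge0//.
        rewrite ler_expR -[leRHS]mulr1 ler_wpM2l ?expR_ge0//.
        by rewrite -expR0 ler_expR oppr_le0 sqr_ge0.
      by rewrite -expR0 ler_expR sqr_ge0.
    apply/funext => t /=; rewrite normrN [in RHS]normrM (ger0_norm (expR_ge0 (_ * _))).
    by rewrite (@ger0_norm _ (_ * _)) ?mulr_ge0 ?expR_ge0.
  move=> j.
  rewrite -(mulr0 ((- expR (n%:R ^+ 2)) ^+ j)) -(gauss_power_moments0 (x + n%:R) j gk k0).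
  rewrite -RintegralZl//; last exact/integrable_gdecay/gdecay_gauss_power.
  by apply: eq_Rintegral => t _; rewrite -mulNr exprMn mulrA.
Unshelve. all: by end_near. Qed.

Lemma moments0_ae0 k : gdecay k ->
  (forall p, \int[mu]_t (p.[t] * k t) = 0) -> {ae mu, forall t, k t = 0}.
Proof.
move=> gk k0; have ik := integrable_gdecay gk.
have iy y : mu.-integrable `]-oo, y] (EFin \o k) by apply: integrableS ik.
have := FTC1Ny iy (open_integrable_locally openT ik).
have -> : (fun x => \int[mu]_(t in `]-oo, x]) k t) = cst 0.
  by apply/funext => x; exact: moments0_halfline.
apply: filterS; first exact: (ae_filter_ringOfSetsType mu).
by move=> t /= [_ <-]; rewrite derive1_cst.
Qed.
End moments.

(** * Cosine and sine transforms and their derivatives *)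

Section transforms.
Variable R : realType.
Local Notation mu := (@lebesgue_measure R).
Implicit Types (k f g : R -> R) (p : {poly R}).

(** Used with [g] equal to [cos] or [sin]. The frequency [z] stands for 2 pi xi, so that
    differentiating in [z] brings down exactly the factor [t]. *)
Definition osc g k (z : R) := \int[mu]_t (g (t * z) * k t).

Lemma gdecay_osc g k z : continuous g -> (forall x, `|g x| <= 1) ->
  gdecay k -> gdecay (fun t => g (t * z) * k t).
Proof.
move=> cg g1 gk; apply: gdecay_bounded => //.
apply: measurableT_comp; first exact: continuous_measurable_fun.
exact: measurable_funM.
Qed.

(** Differentiation under the integral sign: as |dg| <= 1, the derivative of the integrand is
    dominated by |t k(t)|, uniformly in the frequency. *)
Lemma is_derive_osc g (dg : R -> R) k (z : R) : (forall x : R, is_derive x 1 g (dg x)) ->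
  (forall x, `|g x| <= 1) -> (forall x, `|dg x| <= 1) -> gdecay k ->
  is_derive z (1 : R) (osc g k) (osc dg (fun t => t * k t) z).
Proof.
move=> gd g1 dg1 gk.
have cg : continuous g.
  by move=> x; apply: differentiable_continuous; apply/derivable1_diffP; case: (gd x).
pose F (x t : R) := g (t * x) * k t.
have dF (x t : R) : is_derive x (1 : R) (F ^~ t) (dg (t * x) * (t * k t)).
  have h1 : is_derive x (1 : R) (t *: (id : R -> R)) t.
    by apply: is_derive_eq; rewrite [LHS]mulr1.
  have h2 := is_deriveZ (k t) (is_derive1_comp (gd (t * x)) h1).
  have -> : F ^~ t = k t *: (g \o (t *: id)).
    by apply/funext => y; rewrite /F mulrC.
  by apply: is_derive_eq h2 _; rewrite [LHS]mulrC -mulrA.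
have d1F x t : partial1of2 F x t = dg (t * x) * (t * k t).
  by rewrite partial1of2E; exact: derive_val.
have Iz : `]z - 1, z + 1[%classic z by rewrite /= in_itv/= ltrBlDr ltrDl ltr01.
have iF x : `]z - 1, z + 1[%classic x -> mu.-integrable setT (EFin \o F x).
  by move=> _; apply: integrable_gdecay; exact: gdecay_osc.
have dF' x t : `]z - 1, z + 1[%classic x -> setT t -> derivable (F ^~ t) x (1 : R).
  by move=> _ _; case: (dF x t).
have iG := integrable_real_norm (integrable_gdecay (gdecay_id gk)).
have bF x t : `]z - 1, z + 1[%classic x -> setT t ->
    `|partial1of2 F x t| <= `|t * k t|.
  by move=> _ _; rewrite d1F normrM ler_piMl.
have G0 t : 0 <= `|t * k t| by [].
apply: DeriveDef; first exact: (derivable_under_integral measurableT Iz iF dF' G0 iG bF).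
rewrite -derive1E (differentiation_under_integral measurableT Iz iF dF' G0 iG bF).
by apply: eq_Rintegral => t _; exact: d1F.
Qed.

Lemma is_derive_osc_cos k (z : R) : gdecay k ->
  is_derive z (1 : R) (osc cos k) (- osc sin (fun t => t * k t) z).
Proof.
move=> gk; have hs (x : R) : `|- sin x| <= 1 by rewrite normrN sin_max.
have := is_derive_osc z (@is_derive_cos R) (@cos_max R) hs gk.
have -> : osc (fun x => - sin x) (fun t => t * k t) z = - osc sin (fun t => t * k t) z.
  rewrite /osc -mulN1r -RintegralZl//.
    by apply: eq_Rintegral => t _; rewrite mulNr mulN1r.
  apply: integrable_gdecay; apply: gdecay_osc; [exact: continuous_sin|exact: sin_max|].
  exact: gdecay_id.
by [].
Qed.

Lemma is_derive_osc_sin k (z : R) : gdecay k ->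
  is_derive z (1 : R) (osc sin k) (osc cos (fun t => t * k t) z).
Proof.
by move=> gk; apply: is_derive_osc => //; [exact: sin_max|exact: cos_max].
Qed.

(** Replacing k(t) by t k(t) differentiates the transforms, up to sign, and so preserves their
    vanishing near 0. The induction on [p] thus generalizes over [k]; the constant coefficient is
    handled by the cosine transform at 0. *)
Lemma osc_moments0 k (e : R) : 0 < e -> gdecay k ->
  (forall z, `|z| < e -> osc cos k z = 0) ->
  (forall z, `|z| < e -> osc sin k z = 0) ->
  forall p, \int[mu]_t (p.[t] * k t) = 0.
Proof.
move=> e0 gk c0 s0 p; elim/poly_ind: p k gk c0 s0 => [|p c IH] k gk c0 s0.
  under eq_Rintegral do rewrite horner0 mul0r.
  by rewrite /Rintegral integral0.
have near0 (f : R -> R) (z df : R) : `|z| < e -> (forall y, `|y| < e -> f y = 0) ->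
    is_derive z (1 : R) f df -> df = 0.
  move=> ze f0 fd.
  have h : \near z, f z = (cst 0 : R -> R) z.
    have zI : z \in `]- e, e[ by rewrite in_itv/= -ltr_norml.
    apply: filterS (near_in_itvoo zI) => y; rewrite in_itv/= -ltr_norml.
    exact: f0.
  have := near_eq_is_derive h fd.
  move=> hd; have := @derive_val _ _ _ _ _ _ _ hd; rewrite derive_cst => <-.
  by [].
have -> : \int[mu]_t ((p * 'X + c%:P).[t] * k t) =
    \int[mu]_t (p.[t] * (t * k t) + c * k t).
  by apply: eq_Rintegral => t _; rewrite hornerMXaddC mulrDl mulrA.
have gtk := gdecay_id gk.
rewrite RintegralD//; first last.
- exact/integrable_gdecay/gdecay_cst.
- exact/integrable_gdecay/gdecay_horner.
rewrite IH//.
- rewrite add0r RintegralZl//; last exact: integrable_gdecay.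
  have := c0 0; rewrite normr0 => /(_ e0); rewrite /osc.
  by under eq_Rintegral do rewrite mulr0 cos0 mul1r; move=> ->; rewrite mulr0.
- move=> z ze; exact: near0 ze s0 (is_derive_osc_sin z gk).
- move=> z ze; apply/eqP; rewrite -oppr_eq0; apply/eqP.
  exact: near0 ze c0 (is_derive_osc_cos z gk).
Qed.
End transforms.

(** * Complex curves with equal modulus and locally constant quotient *)

Lemma is_derive0_ball_cst (R : realType) (f : R -> R) (a e : R) :
  (forall z : R, `|z - a| < e -> is_derive z (1 : R) f 0) ->
  forall z, `|z - a| < e -> f z = f a.
Proof.
move=> df.
have cst x y : x <= y -> `|x - a| < e -> `|y - a| < e -> f x = f y.
  move=> xy xa ya.
  have xya z : z \in `[x, y] -> `|z - a| < e.
    by rewrite in_itv/= => /andP[xz zy]; move: xa ya; rewrite !ltr_norml; lra.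
  have [z zxy| |c cxy] := @MVT_segment R f (cst 0) x y xy.
  - by apply/df/xya/subset_itv_oo_cc.
  - apply: derivable_within_continuous => z zxy.
    by case: (df z (xya z zxy)).
  - by rewrite mul0r => /eqP; rewrite subr_eq0 => /eqP.
move=> z za; have e0 : `|a - a| < e by rewrite subrr normr0 (le_lt_trans _ za).
by have [|/ltW] := leP z a => h; [exact: cst|rewrite (cst _ _ h)].
Qed.

Section quotient.
Variables (R : realType) (f1 f2 g1 g2 df1 df2 dg1 dg2 : R -> R).
(** The curves are F = f1 + i f2 and G = g1 + i g2. In [imE] the two sides are the imaginary parts
    of F conj(F') and G conj(G'). *)
Hypothesis Df1 : forall z : R, is_derive z (1 : R) f1 (df1 z).
Hypothesis Df2 : forall z : R, is_derive z (1 : R) f2 (df2 z).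
Hypothesis Dg1 : forall z : R, is_derive z (1 : R) g1 (dg1 z).
Hypothesis Dg2 : forall z : R, is_derive z (1 : R) g2 (dg2 z).
Hypothesis normE : forall z, f1 z ^+ 2 + f2 z ^+ 2 = g1 z ^+ 2 + g2 z ^+ 2.
Hypothesis imE : forall z,
  f2 z * df1 z - f1 z * df2 z = g2 z * dg1 z - g1 z * dg2 z.

Let normD (u v du dv : R -> R) (z : R) : is_derive z (1 : R) u (du z) ->
  is_derive z (1 : R) v (dv z) ->
  is_derive z (1 : R) (u * u + v * v) (2 * (u z * du z + v z * dv z)).
Proof.
move=> Du Dv; apply: is_derive_eq (is_deriveD (is_deriveM Du Du) (is_deriveM Dv Dv)) _.
by rewrite /GRing.scale/=; ring.
Qed.

(** Half the derivative of [normE]; together with [imE] it yields F conj(F') = G conj(G'). *)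
Let reE z : f1 z * df1 z + f2 z * df2 z = g1 z * dg1 z + g2 z * dg2 z.
Proof.
have E : f1 * f1 + f2 * f2 = g1 * g1 + g2 * g2.
  by apply/funext => y; have := normE y; rewrite !expr2.
have := @derive_val _ _ _ _ _ _ _ (normD (Df1 z) (Df2 z)).
by rewrite E (@derive_val _ _ _ _ _ _ _ (normD (Dg1 z) (Dg2 z))); lra.
Qed.

(** The last premise is the vanishing of the numerator in the quotient rule for w / |F|^2. *)
Let quotD (w dw : R -> R) (z : R) : f1 z ^+ 2 + f2 z ^+ 2 != 0 ->
  is_derive z (1 : R) w (dw z) ->
  dw z * (f1 z ^+ 2 + f2 z ^+ 2) = w z * (2 * (f1 z * df1 z + f2 z * df2 z)) ->
  is_derive z (1 : R) (w * (fun y => ((f1 * f1 + f2 * f2) y)^-1)) 0.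
Proof.
rewrite !expr2 => N0 Dw E.
have DV := @is_deriveV R (f1 * f1 + f2 * f2) z _ 1 N0 (normD (Df1 z) (Df2 z)).
apply: is_derive_eq (is_deriveM Dw DV) _.
have -> : dw z = w z * (2 * (f1 z * df1 z + f2 z * df2 z)) /
  (f1 z * f1 z + f2 z * f2 z) by rewrite -E mulfK.
by rewrite /GRing.scale/= !fctE; field.
Qed.

(** From F conj(F') = G conj(G') and |F| = |G|, the logarithmic derivatives F'/F and G'/G agree
    where F is nonzero, so G/F is constant near any such point. *)
Lemma quotient_cst : exists a e c1 c2 : R, [/\ 0 < e, c1 ^+ 2 + c2 ^+ 2 = 1 &
  forall z, `|z - a| < e -> g1 z = c1 * f1 z - c2 * f2 z /\
                            g2 z = c2 * f1 z + c1 * f2 z].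
Proof.
have [[a Na]|F0] := pselect (exists a, f1 a ^+ 2 + f2 a ^+ 2 != 0); last first.
  (* If F is identically 0, so is G by [normE], and the constant 1 serves on the interval of radius
     1 around 0. *)
  exists 0, 1, 1, 0; split => // [|z _]; first by rewrite expr1n expr0n addr0.
  have N0 : f1 z ^+ 2 + f2 z ^+ 2 = 0.
    by apply/eqP; apply/negPn/negP => h; apply: F0; exists z.
  have zero (x y : R) : x ^+ 2 + y ^+ 2 = 0 -> x = 0 /\ y = 0.
    move=> /eqP; rewrite paddr_eq0 ?sqr_ge0// !sqrf_eq0 => /andP[/eqP -> /eqP ->].
    by [].
  have [-> ->] := zero _ _ N0; move: N0; rewrite normE => /zero[-> ->].
  by rewrite !mulr0 subr0 addr0.
have [e e0 Ne] : exists2 e : R, 0 < e &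
    forall z, `|z - a| < e -> f1 z ^+ 2 + f2 z ^+ 2 != 0.
  have cN : {for a, continuous (f1 * f1 + f2 * f2)}.
    apply: differentiable_continuous; apply/derivable1_diffP.
    by case: (normD (Df1 a) (Df2 a)).
  have := cN; rewrite /continuous_at => /cvgr_neq0.
  move=> /(_ Na) /nbhs_ballP[e /= e0 he]; exists e => // z za.
  by have := he z; rewrite /ball/= distrC => /(_ za); rewrite !expr2.
pose N z := f1 z ^+ 2 + f2 z ^+ 2.
(* Here w1 + i w2 = G conj(F), so multiplying by [V] = 1/|F|^2 gives G/F. *)
pose w1 := g1 * f1 + g2 * f2.
pose w2 := g2 * f1 - g1 * f2.
pose V := fun y => ((f1 * f1 + f2 * f2) y)^-1.
(* [k1] and [k2] are the real and imaginary parts of |F|^2 G' = G conj(F) F'. *)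
have k1 z : N z * dg1 z = g1 z * (f1 z * df1 z + f2 z * df2 z) -
   g2 z * (f1 z * df2 z - f2 z * df1 z).
  have := imE z; rewrite /N normE reE; move/(congr1 (fun x => - g2 z * x)).
  lra.
have k2 z : N z * dg2 z = g1 z * (f1 z * df2 z - f2 z * df1 z) +
   g2 z * (f1 z * df1 z + f2 z * df2 z).
  have := imE z; rewrite /N normE reE; move/(congr1 (fun x => - g1 z * x)).
  lra.
have D1 z : `|z - a| < e -> is_derive z (1 : R) (w1 * V) 0.
  move=> za; apply: (quotD (dw := fun z => dg1 z * f1 z + g1 z * df1 z +
     dg2 z * f2 z + g2 z * df2 z)); first exact: Ne.
    apply: is_derive_eq (is_deriveD (is_deriveM (Dg1 z) (Df1 z)) (is_deriveM (Dg2 z) (Df2 z))) _.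
    by rewrite /GRing.scale/=; ring.
  transitivity (f1 z * (N z * dg1 z) + f2 z * (N z * dg2 z) + N z * (g1 z * df1 z + g2 z * df2 z)).
    by rewrite /N; ring.
  by rewrite k1 k2 /N /w1 !fctE; ring.
have D2 z : `|z - a| < e -> is_derive z (1 : R) (w2 * V) 0.
  move=> za; apply: (quotD (dw := fun z => dg2 z * f1 z + g2 z * df1 z -
     dg1 z * f2 z - g1 z * df2 z)); first exact: Ne.
    apply: is_derive_eq (is_deriveB (is_deriveM (Dg2 z) (Df1 z)) (is_deriveM (Dg1 z) (Df2 z))) _.
    by rewrite /GRing.scale/=; ring.
  transitivity (f1 z * (N z * dg2 z) - f2 z * (N z * dg1 z) + N z * (g2 z * df1 z - g1 z * df2 z)).
    by rewrite /N; ring.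
  by rewrite k1 k2 /N /w2 !fctE; ring.
exists a, e, ((w1 * V) a), ((w2 * V) a); split => //.
  (* The squared modulus of G/F at [a] is |G|^2 |F|^2 / |F|^4, which is 1 by [normE]. *)
  have -> : (w1 * V) a ^+ 2 + (w2 * V) a ^+ 2 =
     (g1 a ^+ 2 + g2 a ^+ 2) * N a / (N a) ^+ 2.
    by rewrite /w1 /w2 /V /N !fctE; field.
  by rewrite -normE -/(N a) -expr2 divff// expf_neq0.
move=> z za.
rewrite -(is_derive0_ball_cst D1 za) -(is_derive0_ball_cst D2 za).
by have := Ne z za; rewrite /w1 /w2 /V !fctE => Nz; split; field.
Qed.
End quotient.

(** * The Fourier transform through real and imaginary parts *)

Section fourier.
Variable R : realType.
Local Notation mu := (@lebesgue_measure R).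
Implicit Types (k g U V : R -> R).

Lemma integrable_osc_cos k z : gdecay k ->
  mu.-integrable setT (EFin \o (fun t => cos (t * z) * k t)).
Proof.
move=> gk; apply: integrable_gdecay; apply: gdecay_osc => //.
  exact: continuous_cos.
exact: cos_max.
Qed.

Lemma integrable_osc_sin k z : gdecay k ->
  mu.-integrable setT (EFin \o (fun t => sin (t * z) * k t)).
Proof.
move=> gk; apply: integrable_gdecay; apply: gdecay_osc => //.
  exact: continuous_sin.
exact: sin_max.
Qed.

Lemma osc_cos_lin k1 k2 (a b : R) z : gdecay k1 -> gdecay k2 ->
  osc cos (fun t => a * k1 t + b * k2 t) z = a * osc cos k1 z + b * osc cos k2 z.
Proof.
move=> g1 g2; have i1 := integrable_osc_cos z g1; have i2 := integrable_osc_cos z g2.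
rewrite /osc -!RintegralZl// -RintegralD//; [|exact: integrable_realM..].
by apply: eq_Rintegral => t _; ring.
Qed.

Lemma osc_sin_lin k1 k2 (a b : R) z : gdecay k1 -> gdecay k2 ->
  osc sin (fun t => a * k1 t + b * k2 t) z = a * osc sin k1 z + b * osc sin k2 z.
Proof.
move=> g1 g2; have i1 := integrable_osc_sin z g1; have i2 := integrable_osc_sin z g2.
rewrite /osc -!RintegralZl// -RintegralD//; [|exact: integrable_realM..].
by apply: eq_Rintegral => t _; ring.
Qed.

Lemma gdecay_lin k1 k2 (a b : R) : gdecay k1 -> gdecay k2 ->
  gdecay (fun t => a * k1 t + b * k2 t).
Proof. by move=> g1 g2; apply: gdecayD; exact: gdecay_cst. Qed.

(** The real part of the transform of U + iV. The imaginary part is the same expression for V and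
    -U, that is, for -i(U + iV). *)
Definition reT U V z := osc cos U z + osc sin V z.

Lemma reTE U V z : gdecay U -> gdecay V ->
  reT U V z = \int[mu]_t (cos (t * z) * U t + sin (t * z) * V t).
Proof.
move=> gU gV; rewrite RintegralD//; first exact: integrable_osc_cos.
exact: integrable_osc_sin.
Qed.

Lemma osc_sinN k z : gdecay k -> osc sin (fun t => - k t) z = - osc sin k z.
Proof.
move=> gk; have := osc_sin_lin (-1) 0 z gk gk.
rewrite mul0r addr0 mulN1r => <-.
by apply: eq_Rintegral => t _; rewrite mulN1r mul0r addr0.
Qed.

Lemma osc_cos_opp k z : osc cos k (- z) = osc cos k z.
Proof. by apply: eq_Rintegral => t _; rewrite mulrN cosN. Qed.

Lemma osc_sin_opp k z : gdecay k -> osc sin k (- z) = - osc sin k z.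
Proof.
move=> gk; rewrite -osc_sinN//.
by apply: eq_Rintegral => t _; rewrite mulrN sinN mulrN mulNr.
Qed.

(** Modulation moves the interval where the transform vanishes to one centred at 0. There all cosine
    and sine transforms vanish separately, hence so do all moments. *)
Lemma fourier_ball0_ae0 U V (a e : R) : 0 < e -> gdecay U -> gdecay V ->
  (forall z, `|z - a| < e -> osc cos U z + osc sin V z = 0) ->
  (forall z, `|z - a| < e -> osc cos V z - osc sin U z = 0) ->
  {ae mu, forall t, U t = 0 /\ V t = 0}.
Proof.
move=> e0 gU gV reU imU.
(* u + iv = e^{-ita} (U + iV), whose transform at [y] is that of U + iV at a + y. *)
pose u t := cos (t * a) * U t + sin (t * a) * V t.
pose v t := cos (t * a) * V t - sin (t * a) * U t.
have gc k : gdecay k -> gdecay (fun t => cos (t * a) * k t).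
  by move=> gk; apply: gdecay_osc => //; [exact: continuous_cos|exact: cos_max].
have gs k : gdecay k -> gdecay (fun t => sin (t * a) * k t).
  by move=> gk; apply: gdecay_osc => //; [exact: continuous_sin|exact: sin_max].
have gu : gdecay u by apply: gdecayD; [exact: gc|exact: gs].
have gv : gdecay v by apply: gdecayD; [exact: gc|apply: gdecayN; exact: gs].
have reu y : `|y| < e -> osc cos u y + osc sin v y = 0.
  move=> ye; transitivity (reT U V (a + y)); last first.
    by apply: reU; rewrite addrAC subrr add0r.
  rewrite -/(reT u v y) !reTE//; apply: eq_Rintegral => t _.
  by rewrite (mulrDr t) cosD sinD /u /v; ring.
have imu y : `|y| < e -> osc cos v y - osc sin u y = 0.
  move=> ye; have gNu := gdecayN gu; have gNU := gdecayN gU.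
  transitivity (reT V (fun t => - U t) (a + y)); last first.
    by rewrite /reT osc_sinN//; apply: imU; rewrite addrAC subrr add0r.
  rewrite -osc_sinN// -/(reT v (fun t => - u t) y) !reTE//.
  apply: eq_Rintegral => t _.
  by rewrite (mulrDr t) cosD sinD /u /v; ring.
(* The equations at [y] and [-y] separate the even cosine transforms from the odd sine
   transforms. *)
have [cu su cv sv] : [/\ forall y, `|y| < e -> osc cos u y = 0,
    forall y, `|y| < e -> osc sin u y = 0,
    forall y, `|y| < e -> osc cos v y = 0 &
    forall y, `|y| < e -> osc sin v y = 0].
  by split=> y ye; have := reu y ye; have := imu y ye;
    have := reu (- y); have := imu (- y);
    rewrite normrN !osc_cos_opp !osc_sin_opp// => /(_ ye) + /(_ ye); lra.
have u0 := moments0_ae0 gu (osc_moments0 e0 gu cu su).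
have v0 := moments0_ae0 gv (osc_moments0 e0 gv cv sv).
apply: filterS2 u0 v0; first exact: (ae_filter_ringOfSetsType mu).
move=> t; rewrite /u /v => u0 v0.
have cs := cos2Dsin2 (t * a).
(* The modulation is undone: U + iV = e^{ita} (u + iv). *)
split.
  transitivity (U t * (cos (t * a) ^+ 2 + sin (t * a) ^+ 2)); first by rewrite cs mulr1.
  transitivity (cos (t * a) * (cos (t * a) * U t + sin (t * a) * V t) -
    sin (t * a) * (cos (t * a) * V t - sin (t * a) * U t)); first by ring.
  by rewrite u0 v0 !mulr0 subr0.
transitivity (V t * (cos (t * a) ^+ 2 + sin (t * a) ^+ 2)); first by rewrite cs mulr1.
transitivity (sin (t * a) * (cos (t * a) * U t + sin (t * a) * V t) +
  cos (t * a) * (cos (t * a) * V t - sin (t * a) * U t)); first by ring.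
by rewrite u0 v0 !mulr0 addr0.
Qed.

Lemma L2_gdecay (phi : R -> R[i]) : L2 phi ->
  gdecay (fun t => gamma1 t * complex.Re (phi t)) /\
  gdecay (fun t => gamma1 t * complex.Im (phi t)).
Proof.
move=> [mR [mI iRI]]; split; apply: gdecay_gamma1 => //.
  apply: le_integrable_real iRI; first exact: measurable_funX.
  by move=> t; rewrite ger0_norm ?sqr_ge0// lerDl sqr_ge0.
apply: le_integrable_real iRI; first exact: measurable_funX.
by move=> t; rewrite ger0_norm ?sqr_ge0// lerDr sqr_ge0.
Qed.

(** All three windows are affine functions times [gamma1], with (al, be) equal to (1, 0), (0, 2 pi)
    and (1, -2 pi), so one computation covers the three hypotheses. *)
Lemma fourier_affine_gauss (phi : R -> R[i]) (al be xi : R)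
    (a := fun t => gamma1 t * complex.Re (phi t))
    (b := fun t => gamma1 t * complex.Im (phi t)) (z := 2 * pi * xi) :
  gdecay a -> gdecay b ->
  fourier (rmulf (fun t => (al + be * t) * gamma1 t) phi) xi =
  (al * (osc cos a z + osc sin b z) +
   be * (osc cos (fun t => t * a t) z + osc sin (fun t => t * b t) z)) +i*
  (al * (osc cos b z - osc sin a z) +
   be * (osc cos (fun t => t * b t) z - osc sin (fun t => t * a t) z)).
Proof.
move=> ga gb; have gta := gdecay_id ga; have gtb := gdecay_id gb.
rewrite /fourier; congr (_ +i* _).
  transitivity (reT (fun t => al * a t + be * (t * a t))
                    (fun t => al * b t + be * (t * b t)) z).
    rewrite reTE; [|exact: gdecay_lin..].
    apply: eq_Rintegral => t _; rewrite /rmulf /cexpi /z /a /b.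
    case: (phi t) => x y /=; rewrite mulrA (mulrC t) -mulrA cosN sinN.
    by rewrite (mulrC t xi) !mulrA; ring.
  by rewrite /reT osc_cos_lin// osc_sin_lin//; ring.
transitivity (reT (fun t => al * b t + be * (t * b t))
                  (fun t => - (al * a t + be * (t * a t))) z).
  rewrite reTE; [|exact: gdecay_lin|apply: gdecayN; exact: gdecay_lin].
  apply: eq_Rintegral => t _; rewrite /rmulf /cexpi /z /a /b.
  case: (phi t) => x y /=; rewrite mulrA (mulrC t) -mulrA cosN sinN.
  by rewrite (mulrC t xi) !mulrA; ring.
rewrite /reT osc_sinN; last exact: gdecay_lin.
by rewrite osc_cos_lin// osc_sin_lin//; ring.
Qed.

Lemma normc_eq_sqr (x y x' y' : R) : `|x +i* y| = `|x' +i* y'| ->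
  x ^+ 2 + y ^+ 2 = x' ^+ 2 + y' ^+ 2.
Proof.
rewrite !normc_def => -[] /= /(congr1 (fun r => r ^+ 2)).
by rewrite !sqr_sqrtr ?addr_ge0 ?sqr_ge0.
Qed.

Lemma gamma1E : @gamma1 R = fun t => (1 + 0 * t) * gamma1 t.
Proof. by apply/funext => t; rewrite mul0r addr0 mul1r. Qed.

Lemma gamma2E : @gamma2 R = fun t => (0 + 2 * pi * t) * gamma1 t.
Proof. by apply/funext => t; rewrite add0r. Qed.

Lemma gamma3E : @gamma3 R = fun t => (1 + - (2 * pi) * t) * gamma1 t.
Proof. by apply/funext => t; rewrite mulNr. Qed.

End fourier.

(** * From the three moduli to the unimodular constant *)

Theorem mainTheorem2 (R : realType) (phi psi : R -> R[i]) :
  L2 phi -> L2 psi ->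
  (forall xi : R,
     `| fourier (rmulf (@gamma1 R) phi) xi | = `| fourier (rmulf (@gamma1 R) psi) xi |) ->
  (forall xi : R,
     `| fourier (rmulf (@gamma2 R) phi) xi | = `| fourier (rmulf (@gamma2 R) psi) xi |) ->
  (forall xi : R,
     `| fourier (rmulf (@gamma3 R) phi) xi | = `| fourier (rmulf (@gamma3 R) psi) xi |) ->
  exists c : R[i], `| c | = 1 /\
    {ae (@lebesgue_measure R), forall x : R, psi x = c * phi x}.
Proof.
move=> /L2_gdecay[]; set a := (fun t => _); set b := (fun t => _) => ga gb.
move=> /L2_gdecay[]; set a' := (fun t => _); set b' := (fun t => _) => ga' gb'.
have pi0 : 2 * pi != 0 :> R by rewrite mulf_neq0 ?gt_eqF ?pi_gt0.
rewrite gamma1E gamma2E gamma3E => H1 H2 H3.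
have xiE (z : R) : 2 * pi * (z / (2 * pi)) = z by rewrite mulrCA divff// mulr1.
(* F = F1 + i F2 and D = D1 + i D2 are the transforms of [gamma1] phi and t [gamma1] phi, and G and
   E are those for psi. In the variable [z], F' = -iD and G' = -iE. *)
pose F1 z := osc cos a z + osc sin b z.
pose F2 z := osc cos b z - osc sin a z.
pose G1 z := osc cos a' z + osc sin b' z.
pose G2 z := osc cos b' z - osc sin a' z.
pose D1 z := osc cos (fun t => t * a t) z + osc sin (fun t => t * b t) z.
pose D2 z := osc cos (fun t => t * b t) z - osc sin (fun t => t * a t) z.
pose E1 z := osc cos (fun t => t * a' t) z + osc sin (fun t => t * b' t) z.
pose E2 z := osc cos (fun t => t * b' t) z - osc sin (fun t => t * a' t) z.
have {}H1 z : F1 z ^+ 2 + F2 z ^+ 2 = G1 z ^+ 2 + G2 z ^+ 2.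
  have := H1 (z / (2 * pi)); rewrite !fourier_affine_gauss// => /normc_eq_sqr.
  by rewrite !xiE !mul0r !addr0 !mul1r.
have {}H2 z : D1 z ^+ 2 + D2 z ^+ 2 = E1 z ^+ 2 + E2 z ^+ 2.
  have := H2 (z / (2 * pi)); rewrite !fourier_affine_gauss// => /normc_eq_sqr.
  rewrite !xiE !mul0r !add0r !exprMn -!mulrDr => /mulfI; apply.
  by rewrite -exprMn expf_neq0.
(* Polarization: expanding |F - 2 pi D|^2 and removing the squares known from [H1] and [H2] leaves
   the real part of F conj(D), which is the imaginary part of F conj(F'). *)
have {}H3 z : F1 z * D1 z + F2 z * D2 z = G1 z * E1 z + G2 z * E2 z.
  have := H3 (z / (2 * pi)); rewrite !fourier_affine_gauss// => /normc_eq_sqr.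
  rewrite !xiE !mul1r -/(F1 z) -/(F2 z) -/(G1 z) -/(G2 z).
  rewrite -/(D1 z) -/(D2 z) -/(E1 z) -/(E2 z) => H.
  have h1 := H1 z; have h2 := H2 z; apply: (mulfI pi0); nra.
have DF1 k k' (z : R) : gdecay k -> gdecay k' ->
    is_derive z (1 : R) (fun z => osc cos k z + osc sin k' z)
      (osc cos (fun t => t * k' t) z - osc sin (fun t => t * k t) z).
  move=> gk gk'.
  apply: is_derive_eq (is_deriveD (is_derive_osc_cos z gk) (is_derive_osc_sin z gk')) _.
  by rewrite addrC.
have DF2 k k' (z : R) : gdecay k -> gdecay k' ->
    is_derive z (1 : R) (fun z => osc cos k' z - osc sin k z)
      (- (osc cos (fun t => t * k t) z + osc sin (fun t => t * k' t) z)).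
  move=> gk gk'.
  apply: is_derive_eq (is_deriveB (is_derive_osc_cos z gk') (is_derive_osc_sin z gk)) _.
  by rewrite opprD addrC.
have [x0 [e [c1 [c2 [e0 c12 cE]]]]] : exists a e c1 c2 : R,
  [/\ 0 < e, c1 ^+ 2 + c2 ^+ 2 = 1 &
  forall z, `|z - a| < e -> G1 z = c1 * F1 z - c2 * F2 z /\
                            G2 z = c2 * F1 z + c1 * F2 z].
  (* The derivatives are read off from -iD = D2 - i D1, and likewise for E. *)
  apply: (@quotient_cst _ F1 F2 G1 G2 D2 (fun z => - D1 z) E2 (fun z => - E1 z)) => //.
  - by move=> z; exact: DF1.
  - by move=> z; exact: DF2.
  - by move=> z; exact: DF1.
  - by move=> z; exact: DF2.
  - by move=> z; have := H3 z; lra.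
exists (c1 +i* c2); split; first by rewrite normc_def /= c12 sqrtr1.
(* U + iV = [gamma1] (psi - c phi), with coefficients displayed in the form expected by
   [osc_cos_lin] and [osc_sin_lin]. *)
pose U t := 1 * a' t + (-1) * (c1 * a t + (- c2) * b t).
pose V t := 1 * b' t + (-1) * (c2 * a t + c1 * b t).
have gl x y := gdecay_lin x y ga gb.
have gU : gdecay U by apply: gdecay_lin.
have gV : gdecay V by apply: gdecay_lin.
have : {ae (@lebesgue_measure R), forall t, U t = 0 /\ V t = 0}.
  apply: (fourier_ball0_ae0 e0 gU gV) => z zx; have [] := cE z zx;
    rewrite osc_cos_lin// !osc_sin_lin// !osc_cos_lin// /F1 /F2 /G1 /G2; lra.
apply: filterS; first exact: (ae_filter_ringOfSetsType (@lebesgue_measure R)).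
move=> t; rewrite /U /V /a /b /a' /b'.
case: (phi t) (psi t) => x y [x' y'] /= [U0 V0].
have g0 : gamma1 t != 0 by rewrite gt_eqF ?expR_gt0.
by apply/eqP; rewrite eq_complex/=; apply/andP; split; apply/eqP;
  apply: (mulfI g0); lra.
Qed.
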